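(* Let $f\in\mathcal{D}([a,b])$ and $h>0$. Then $$\omega^{(U)}_h(f)=\max\bigl\{\omega^+_h(f),\,\omega^-_h(f)\bigr\}.$$
   Context: $[a,b]\subset\mathbb{R}$ is a compact interval and $\mathcal{D}([a,b])$ is the space of càdlàg functions on $[a,b]$ (right-continuous with left limits; following Skorokhod, also left-continuous at $b$). With $x_+=\max\{x,0\}$ and $x_-=\max\{-x,0\}$: $$\omega^{(U)}_h(f)=\sup_{u,u'\in[a,b]:\,|u-u'|\leq h}|f(u)-f(u')|,$$ the modulus of increase is $$\omega^+_h(f)=\sup_{u,v\in[a,b]:\,u\leq v\leq u+h}\bigl(f(v)-f(u)\bigr)_+,$$ and the modulus of decrease is $$\omega^-_h(f)=\sup_{u,v\in[a,b]:\,u\leq v\leq u+h}\bigl(f(v)-f(u)\bigr)_-.$$ *)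

(* Defs.v *)
(* MathComp / MathComp-Analysis *)
From mathcomp Require Import all_boot all_order all_algebra.
From mathcomp Require Import all_classical all_reals all_analysis.

Set Implicit Arguments.
Unset Strict Implicit.
Unset Printing Implicit Defensive.

Import Order.TTheory GRing.Theory Num.Theory.
Import numFieldNormedType.Exports.

Local Open Scope classical_set_scope.
Local Open Scope ring_scope.

(* Functions on [a, b] are total functions R -> R of which only the values on
   [a, b] matter: each one-sided limit below is taken at a point from which
   the relevant side is, locally, inside [a, b].  For a = b no limit condition
   remains. *)
Definition cadlag (R : realType) (a b : R) : set (R -> R) :=
  [set f : R -> R | [/\ forall t, a <= t < b -> f x @[x --> t^'+] --> f t,
                       forall t, a < t <= b -> cvg (f x @[x --> t^'-])
                     & a < b -> f x @[x --> b^'-] --> f b]].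

Definition pos_part (R : realType) (x : R) : R := Num.max x 0.

Definition neg_part (R : realType) (x : R) : R := Num.max (- x) 0.

(* The suprema are taken in \bar R, so that they are meaningful without a
   boundedness proof. *)
Definition modulus_unif (R : realType) (a b h : R) (f : R -> R) : \bar R :=
  ereal_sup [set (`|f p.1 - f p.2|)%:E | p in
    [set p : R * R | [/\ p.1 \in `[a, b], p.2 \in `[a, b]
                       & `|p.1 - p.2| <= h]]].

Definition modulus_incr (R : realType) (a b h : R) (f : R -> R) : \bar R :=
  ereal_sup [set (pos_part (f p.2 - f p.1))%:E | p in
    [set p : R * R | [/\ p.1 \in `[a, b], p.2 \in `[a, b]
                       & p.1 <= p.2 <= p.1 + h]]].

Definition modulus_decr (R : realType) (a b h : R) (f : R -> R) : \bar R :=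
  ereal_sup [set (neg_part (f p.2 - f p.1))%:E | p in
    [set p : R * R | [/\ p.1 \in `[a, b], p.2 \in `[a, b]
                       & p.1 <= p.2 <= p.1 + h]]].

(* Main.v *)
Require Import Defs.
From mathcomp Require Import all_boot all_order all_algebra.
From mathcomp Require Import all_classical all_reals all_analysis.

Import Order.TTheory GRing.Theory Num.Theory.

Local Open Scope ring_scope.

(** The absolute value is the larger of the positive and negative parts ([norm_max_parts]), and the
    supremum of a pointwise maximum is the maximum of the suprema. The unordered pairs at distance
    at most [h] reduce to ordered ones because swapping the points preserves both their distance and
    the size of the increment. Comparing upper bounds in [\bar R] also covers infinite suprema. *)

Lemma norm_max_parts (R : realType) (x : R) :
  `|x| = Num.max (pos_part x) (neg_part x).
Proof.
rewrite /pos_part /neg_part; have [x0|x0] := leP 0 x.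
  have Nx0 : - x <= 0 by rewrite oppr_le0.
  by rewrite ger0_norm // (max_r Nx0) max_l.
have Nx0 : 0 <= - x by rewrite oppr_ge0 ltW.
by rewrite ltr0_norm // (max_l Nx0) max_r.
Qed.

Lemma pos_part_le_norm (R : realType) (x : R) : pos_part x <= `|x|.
Proof. by rewrite norm_max_parts le_max lexx. Qed.

Lemma neg_part_le_norm (R : realType) (x : R) : neg_part x <= `|x|.
Proof. by rewrite norm_max_parts le_max lexx orbT. Qed.

Theorem proposition16 (R : realType) (a b : R) (hab : a <= b)
    (f : R -> R) (hf : cadlag a b f) (h : R) (hh : 0 < h) :
  modulus_unif a b h f = Order.max (modulus_incr a b h f) (modulus_decr a b h f).
Proof.
apply/eqP; rewrite eq_le ge_max; apply/and3P; split.
- apply: ge_ereal_sup => _ [[u v] /= [ua va uvh] <-].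
  (* The distance constraint and the absolute increment are both symmetric in [u] and [v]. *)
  wlog uv : u v ua va uvh / u <= v => [th|].
    have [/th|/ltW /th] := leP u v; first exact.
    by rewrite (distrC v u) (distrC (f v)); exact.
  have uvh' : u <= v <= u + h.
    by rewrite uv -lerBlDl (le_trans _ uvh) // distrC ler_norm.
  (* The single ordered pair [(u, v)] is admissible for both one-sided moduli, so each part of the
     increment is bounded by its own modulus. *)
  rewrite distrC norm_max_parts EFin_max ge_max !le_max; apply/andP; split.
    by apply/orP; left; apply: ereal_sup_ubound; exists (u, v).
  by apply/orP; right; apply: ereal_sup_ubound; exists (u, v).
- apply: ge_ereal_sup => _ [[u v] /= [ua va /andP[uv vuh]] <-].
  apply: (@le_trans _ _ `|f v - f u|%:E); first by rewrite lee_fin pos_part_le_norm.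
  (* The pair is reversed, here and in the next case, because [modulus_unif] subtracts the value at
     the second point from that at the first. *)
  apply: ereal_sup_ubound; exists (v, u) => //=; split=> //.
  by rewrite ger0_norm ?subr_ge0 // lerBlDl.
- apply: ge_ereal_sup => _ [[u v] /= [ua va /andP[uv vuh]] <-].
  apply: (@le_trans _ _ `|f v - f u|%:E); first by rewrite lee_fin neg_part_le_norm.
  apply: ereal_sup_ubound; exists (v, u) => //=; split=> //.
  by rewrite ger0_norm ?subr_ge0 // lerBlDl.
Qed.
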